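(* Let $\mathbf{x}\in\mathbb{R}^{\infty}$, $\sigma_0>1$ and $n\in\mathbb{N}$. Then there exists a relatively dense set of real numbers $\{t_{n,m}\}_{m\geq 1}$ such that, for each $m=1,2,\ldots$, the parametrized curve traced by the points $(\operatorname{Re}(\zeta_{\mathbf{x}}(\sigma+it_{n,m})),\operatorname{Im}(\zeta_{\mathbf{x}}(\sigma+it_{n,m})))$, where $\sigma\in(1,\sigma_0)$, makes at least $n$ turns around the origin.
   Context: Let $p_k$ denote the $k$-th prime number. $\mathbb{R}^{\infty}$ is the set of all real sequences $\mathbf{x}=(x_1,x_2,\ldots)$. For $\mathbf{x}\in\mathbb{R}^{\infty}$ define, for $\operatorname{Re}s>1$, $$\zeta_{\mathbf{x}}(s)=\sum_{n\ge1}\frac{e^{i\langle\mathbf{r}_n,\mathbf{x}\rangle}}{n^{s}},$$ where, if $n=\prod_k p_k^{\alpha_k}$ is the prime factorization of $n$, $\mathbf{r}_n=(\alpha_1,\alpha_2,\ldots)$ and $\langle\mathbf{r}_n,\mathbf{x}\rangle=\sum_k\alpha_k x_k$ (a finite sum). The series converges absolutely for $\operatorname{Re}s>1$, and $\zeta_{\mathbf{x}}$ has no zeros there. A set $T\subset\mathbb{R}$ is relatively dense if there is $L>0$ such that every interval of length $L$ contains a point of $T$. For a continuous curve $\gamma:I\to\mathbb{C}\setminus\{0\}$ on an open interval $I$, with a continuous choice of argument $\varphi:I\to\mathbb{R}$ (so $\gamma=|\gamma|e^{i\varphi}$), the curve makes at least $n$ turns around the origin if there are $\sigma_1,\sigma_2\in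 I$ with $|\varphi(\sigma_1)-\varphi(\sigma_2)|\ge 2\pi n$. *)

(* Defs.v *)
From Stdlib Require Import Reals.
From Coquelicot Require Import Coquelicot.
From mathcomp Require Import ssreflect ssrbool eqtype ssrnat prime.

Lemma ex_prime_above (m : nat) : exists p : nat, (m < p)%N && prime p.
Proof. by case: (prime_above m) => p mp pp; exists p; rewrite mp pp. Qed.

Definition next_prime (m : nat) : nat := ex_minn (ex_prime_above m).

(* Indexing starts at 0: [nth_prime k] is p_{k+1}, so that nth_prime 0 = 2.
   A sequence x : nat -> R is indexed in the same way: [x k] is x_{k+1}. *)
Fixpoint nth_prime (k : nat) : nat :=
  match k with
  | 0%N => 2
  | k'.+1 => next_prime (nth_prime k')
  end.

Definition exponents (n k : nat) : nat := logn (nth_prime k) n.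

(* The sum over all k is finite: nth_prime k > k, so the exponents with k >= n
   vanish and the sum over 0 <= k <= n is the full one. *)
Definition exponents_dot (n : nat) (x : nat -> R) : R :=
  sum_n (fun k : nat => (INR (exponents n k) * x k)%R) n.

Definition Cexp (z : C) : C :=
  (exp (Re z) * cos (Im z), exp (Re z) * sin (Im z))%R.

(* n^s for n >= 1. *)
Definition nat_Cpow (n : nat) (s : C) : C := Cexp (s * RtoC (ln (INR n)))%C.

Definition zeta_term (x : nat -> R) (s : C) (n : nat) : C :=
  (Cexp (Ci * RtoC (exponents_dot n x)) / nat_Cpow n s)%C.

(* The sum of the series over n >= 1; [iota] picks the unique complex number
   satisfying the predicate, when there is one. *)
Definition zeta (x : nat -> R) (s : C) : C :=
  iota (T := C_CompleteNormedModule)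
    (fun l : C => is_series (V := C_NormedModule)
                    (fun n : nat => zeta_term x s n.+1) l).

(* Asking for a point in the open interval covers every interval of length L. *)
Definition relatively_dense (T : R -> Prop) : Prop :=
  exists L : R, (0 < L)%R /\
    forall a : R, exists t : R, T t /\ (a < t < a + L)%R.

Definition is_arg_on (a b : R) (g : R -> C) (phi : R -> R) : Prop :=
  forall u : R, (a < u < b)%R ->
    continuous phi u /\ g u = (RtoC (Cmod (g u)) * Cexp (Ci * RtoC (phi u)))%C.

Definition makes_turns (a b : R) (g : R -> C) (n : nat) : Prop :=
  (forall u : R, (a < u < b)%R -> continuous g u /\ g u <> RtoC 0) /\
  exists phi : R -> R, is_arg_on a b g phi /\
    exists u1 u2 : R, (a < u1 < b)%R /\ (a < u2 < b)%R /\
      (2 * PI * INR n <= Rabs (phi u1 - phi u2))%R.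

(* Main.v *)
(* The curve for t turns around the origin as much as the argument
   phi_t(s) = sum_k arg (1 - e^(i (x_k - t ln p_k)) p_k^(-s))^(-1) varies on
   (1, sigma0); that phi_t is an argument of zeta_x, and that zeta_x does not
   vanish, follows from the Euler product.  Fix s2 in (1, sigma0): phi_t(s2) is
   bounded uniformly in t.  Up to a bounded error, phi_t(s1) is the sum of
   p_k^(-s1) sin (x_k - t ln p_k) over k <= N for N large.  Instead of making all
   these sines close to 1 by Kronecker's theorem, average against the Riesz
   product R(t) = prod_(k <= N) (1 + sin (x_k - t ln p_k)) >= 0: by unique
   factorization R has mean 1 and the weighted sum has mean
   (1/2) sum_(k <= N) p_k^(-s1), uniformly over long intervals, so that every
   interval of some fixed length contains a t at which the sum is nearly that
   large.  Since sum_p 1/p diverges, this exceeds any bound for s1 close to 1. *)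
Require Import Defs.
From Stdlib Require Import Reals Lra Lia ClassicalEpsilon.
From Coquelicot Require Import Coquelicot.
From mathcomp Require Import ssreflect ssrfun ssrbool eqtype ssrnat div prime.

Local Open Scope R_scope.

(** * The sequence of primes *)

Lemma next_primeP (m : nat) :
  [/\ (m < next_prime m)%N, prime (next_prime m) &
      forall q : nat, prime q -> (m < q)%N -> (next_prime m <= q)%N].
Proof.
rewrite /next_prime; case: ex_minnP => p /andP[mp pp] pmin; split=> // q pq mq.
by apply: pmin; rewrite mq pq.
Qed.

Lemma prime_nth_prime (k : nat) : prime (nth_prime k).
Proof. by case: k => [//|k]; case: (next_primeP (nth_prime k)). Qed.

Lemma nth_prime_gt0 (k : nat) : (0 < nth_prime k)%N.
Proof. exact: prime_gt0 (prime_nth_prime k). Qed.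

Lemma nth_primeS_gt (k : nat) : (nth_prime k < nth_prime k.+1)%N.
Proof. by case: (next_primeP (nth_prime k)). Qed.

Lemma ltn_nth_prime (j k : nat) : (j < k)%N -> (nth_prime j < nth_prime k)%N.
Proof. exact: (homo_ltn ltn_trans nth_primeS_gt). Qed.

Lemma nth_prime_inj (j k : nat) : (nth_prime j == nth_prime k) = (j == k).
Proof.
apply/eqP/eqP => [e|->//].
by case: (ltngtP j k) => // /ltn_nth_prime; rewrite e ltnn.
Qed.

Lemma nth_prime_lower (k : nat) : (k.+1 < nth_prime k)%N.
Proof. by elim: k => [//|k IH]; apply: leq_trans (nth_primeS_gt k). Qed.

(** No prime is skipped, because [next_prime] returns the least prime above its argument. *)
Lemma prime_below_nth (K q : nat) :
  prime q -> (q < nth_prime K)%N -> exists2 j, (j < K)%N & q = nth_prime j.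
Proof.
move=> pq; elim: K => [|K IH] qK.
  by move: (prime_gt1 pq); rewrite ltnNge -ltnS qK.
case: (ltngtP q (nth_prime K)) => [/IH[j jK ->]|Kq|->]; last by exists K.
- by exists j => //; apply: ltnW.
- case: (next_primeP (nth_prime K)) => _ _ /(_ q pq Kq).
  by rewrite leqNgt qK.
Qed.

Lemma exponents_nth_prime (j k : nat) :
  exponents (nth_prime k) j = (j == k) :> nat.
Proof.
rewrite /exponents logn_prime ?prime_nth_prime //.
by rewrite nth_prime_inj.
Qed.

Lemma exponents_mul (m n k : nat) : (0 < m)%N -> (0 < n)%N ->
  exponents (m * n) k = (exponents m k + exponents n k)%N.
Proof. by move=> m0 n0; rewrite /exponents lognM. Qed.

Lemma exponents_large (n k : nat) : (n <= k)%N -> exponents n k = 0%N.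
Proof.
move=> nk; rewrite /exponents; case: n nk => [|n] nk; first by rewrite logn0.
apply: logn_coprime; rewrite prime_coprime ?prime_nth_prime //.
apply/negP => /dvdn_leq; move/(_ isT) => h.
have := leq_trans (nth_prime_lower k) (leq_trans h nk).
by rewrite ltnNge leqW.
Qed.

Lemma sum_SnR (a : nat -> R) (n : nat) : sum_n a n.+1 = sum_n a n + a n.+1.
Proof. exact: sum_Sn. Qed.

(** The cutoff of [exponents_dot] depends on [n]; padding with vanishing exponents gives different
    numbers a common cutoff, where exponents add termwise. *)
Lemma exponents_dot_widen (x : nat -> R) (n N : nat) : (n <= N)%N ->
  exponents_dot n x = sum_n (fun k => INR (exponents n k) * x k) N.
Proof.
move=> nN; rewrite -(subnKC nN); elim: (N - n)%N => [|d IH].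
  by rewrite addn0.
rewrite addnS sum_Sn -IH exponents_large; last by rewrite leqW ?leq_addr.
by rewrite /plus /= Rmult_0_l Rplus_0_r.
Qed.

Lemma exponents_dot_mul (x : nat -> R) (m n : nat) : (0 < m)%N -> (0 < n)%N ->
  exponents_dot (m * n) x = exponents_dot m x + exponents_dot n x.
Proof.
move=> m0 n0; rewrite (exponents_dot_widen _ m (m * n)) ?leq_pmulr //.
rewrite (exponents_dot_widen _ n (m * n)) ?leq_pmull //.
apply: eq_trans _ (sum_n_plus (G := R_AbelianMonoid) _ _ _).
apply: sum_n_ext => k.
by rewrite exponents_mul // /plus /= -plusE plus_INR Rmult_plus_distr_r.
Qed.

Lemma exponents_dot_nth_prime (x : nat -> R) (k : nat) :
  exponents_dot (nth_prime k) x = x k.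
Proof.
have E N : sum_n (fun j => INR (exponents (nth_prime k) j) * x j) N
   = if (k <= N)%N then x k else 0.
  elim: N => [|N IH].
    rewrite sum_O exponents_nth_prime leqn0 eq_sym.
    by case: eqP => [->|_] /=; lra.
  rewrite sum_Sn IH exponents_nth_prime /plus /=.
  by rewrite -ltnS; case: (ltngtP k N.+1) => [h|h|<-] /=; lra.
rewrite /exponents_dot E.
by rewrite ltnW // ltnW // nth_prime_lower.
Qed.

(** * Mean values of trigonometric polynomials *)

(* Mean value [c], uniformly over all intervals: the deviation from [c] has a
   bounded primitive. *)
Definition has_mean (h : R -> R) (c : R) : Prop :=
  exists H : R -> R, (forall t, is_derive H t (h t - c)) /\
    exists B : R, forall t, Rabs (H t) <= B.

Lemma has_mean_ext (f g : R -> R) (c : R) :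
  (forall t, f t = g t) -> has_mean f c -> has_mean g c.
Proof.
move=> fg [H [dH HB]]; exists H; split=> // t.
by rewrite -fg.
Qed.

Lemma has_mean_const (c : R) : has_mean (fun _ => c) c.
Proof.
exists (fun _ => 0); split=> [t|]; last first.
  by exists 0 => t; rewrite Rabs_R0; lra.
by auto_derive => //; lra.
Qed.

Lemma has_mean_plus (f g : R -> R) (c d : R) :
  has_mean f c -> has_mean g d -> has_mean (fun t => f t + g t) (c + d).
Proof.
move=> [F [dF [A FA]]] [G [dG [B GB]]]; exists (fun t => F t + G t); split=> [t|].
  have -> : f t + g t - (c + d) = plus (f t - c) (g t - d) by rewrite /plus /=; lra.
  exact: is_derive_plus.
exists (A + B) => t; apply: Rle_trans (Rabs_triang _ _) _.
exact: Rplus_le_compat.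
Qed.

Lemma has_mean_scal (f : R -> R) (c a : R) :
  has_mean f c -> has_mean (fun t => a * f t) (a * c).
Proof.
move=> [F [dF [A FA]]]; exists (fun t => a * F t); split=> [t|].
  have -> : a * f t - a * c = a * (f t - c) by lra.
  exact: is_derive_scal.
exists (Rabs a * A) => t; rewrite Rabs_mult.
by apply: Rmult_le_compat_l => //; apply: Rabs_pos.
Qed.

Lemma has_mean_cos (w d : R) : w <> 0 -> has_mean (fun t => cos (w * t + d)) 0.
Proof.
move=> w0; exists (fun t => sin (w * t + d) / w); split=> [t|].
  by auto_derive => //; field.
exists (/ Rabs w) => t; rewrite /Rdiv Rabs_mult Rabs_inv.
rewrite -[X in _ <= X]Rmult_1_l; apply: Rmult_le_compat_r.
  by apply/Rlt_le/Rinv_0_lt_compat/Rabs_pos_lt.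
apply: Rabs_le; case: (SIN_bound (w * t + d)); lra.
Qed.

(* Where [f <= c - e], a primitive of [w * (f - c + e)] decreases while its mean
   slope is [e]; over a long interval this beats the bounded error. *)
Lemma weighted_mean_large (w f : R -> R) (c e : R) :
  (forall t, 0 <= w t) -> has_mean w 1 -> has_mean (fun t => w t * f t) c ->
  0 < e -> exists L, 0 < L /\
    forall a, exists t, a < t < a + L /\ c - e < f t.
Proof.
move=> w0 mw mf e0.
have [H [dH [B HB]]] : has_mean (fun t => w t * f t + (e - c) * w t) (c + (e - c) * 1).
  by apply: has_mean_plus => //; apply: has_mean_scal.
have B0 : 0 <= B by apply: Rle_trans (HB 0); apply: Rabs_pos.
(* Times [e] this length is [2 * B + e], more than the [2 * B] by which [H] can change. *)
exists (2 * B / e + 1).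
have L0 : 0 < 2 * B / e + 1.
  have : 0 <= 2 * B / e by apply: Rdiv_le_0_compat; lra.
  by lra.
split=> // a.
have [t [Et at_]] := MVT_cor2 H _ a (a + (2 * B / e + 1)) ltac:(lra)
  (fun s _ => proj1 (is_derive_Reals _ _ _) (dH s)).
exists t; split=> //; apply: Rnot_le_lt => ft.
have wf : w t * (f t + (e - c)) <= 0.
  have := w0 t; nra.
have := HB a; have := HB (a + (2 * B / e + 1)).
move=> /Rabs_le_between ? /Rabs_le_between ?.
have : H (a + (2 * B / e + 1)) - H a <= - e * (2 * B / e + 1).
  rewrite Et; nra.
have -> : - e * (2 * B / e + 1) = - (2 * B) - e by field; lra.
lra.
Qed.

(** * Riesz products over the primes *)

Definition prime_phase (b : nat -> R) (k : nat) (t : R) : R :=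
  t * ln (INR (nth_prime k)) + b k.

Fixpoint riesz (b : nat -> R) (K : nat) (t : R) : R :=
  if K is k.+1 then riesz b k t * (1 + cos (prime_phase b k t)) else 1.

Lemma riesz_ge0 (b : nat -> R) (K : nat) (t : R) : 0 <= riesz b K t.
Proof.
elim: K => [|k IH] /=; first by lra.
by apply: Rmult_le_pos => //; have := COS_bound (prime_phase b k t); lra.
Qed.

Lemma cos_mul (u v : R) : cos u * cos v = / 2 * cos (u + v) + / 2 * cos (u - v).
Proof. rewrite cos_plus cos_minus; lra. Qed.

Lemma ltR0_INR (n : nat) : (0 < n)%N -> 0 < INR n.
Proof. by move=> /ltP /lt_0_INR. Qed.

(* A factor with index below K multiplies u or v by a prime of index below K,
   so the valuations at indices from K on keep u / v away from 1. *)
Lemma has_mean_riesz_cos (b : nat -> R) (K u v j : nat) (d : R) :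
  (0 < u)%N -> (0 < v)%N -> (K <= j)%N -> exponents u j <> exponents v j ->
  has_mean (fun t => riesz b K t * cos ((ln (INR u) - ln (INR v)) * t + d)) 0.
Proof.
elim: K u v d => [|k IH] u v d u0 v0 Kj uv.
  apply: (has_mean_ext (fun t => cos ((ln (INR u) - ln (INR v)) * t + d))) => [t|].
    by rewrite /= Rmult_1_l.
  (* A zero frequency would give [ln u = ln v], hence [u = v], against the distinct valuations at
     [j]. *)
  apply: has_mean_cos => /Rminus_diag_uniq h; apply: uv.
  by rewrite (INR_eq u v) //; apply: ln_inv h; apply: ltR0_INR.
have jk : j != k by rewrite neq_ltn Kj orbT.
have pk0 := nth_prime_gt0 k.
pose p := nth_prime k.
have lnM (n : nat) : (0 < n)%N -> ln (INR (n * p)) = ln (INR n) + ln (INR p).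
  by move=> n0; rewrite -multE mult_INR ln_mult //; apply: ltR0_INR.
have expM (n : nat) : (0 < n)%N -> exponents (n * p) j = exponents n j.
  by move=> n0; rewrite exponents_mul // exponents_nth_prime (negbTE jk) addn0.
(* Expanding the factor [1 + cos] leaves the given cosine and two new ones, at the frequencies of u
   p / v and u / (v p). *)
have m1 := IH u v d u0 v0 (ltnW Kj) uv.
have m2 := IH (u * p)%N v (d + b k) ltac:(by rewrite muln_gt0 u0) v0 (ltnW Kj)
  ltac:(by rewrite expM).
have m3 := IH u (v * p)%N (d - b k) u0 ltac:(by rewrite muln_gt0 v0) (ltnW Kj)
  ltac:(by rewrite expM).
have := has_mean_plus _ _ _ _ m1
  (has_mean_plus _ _ _ _ (has_mean_scal _ _ (/ 2) m2) (has_mean_scal _ _ (/ 2) m3)).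
have -> : 0 + (/ 2 * 0 + / 2 * 0) = 0 by lra.
apply: has_mean_ext => t; rewrite !lnM //= /prime_phase -/p.
set A := (_ - _) * t + d.
have -> : (ln (INR u) + ln (INR p) - ln (INR v)) * t + (d + b k) =
          A + (t * ln (INR p) + b k) by rewrite /A; ring.
have -> : (ln (INR u) - (ln (INR v) + ln (INR p))) * t + (d - b k) =
          A - (t * ln (INR p) + b k) by rewrite /A; ring.
have := cos_mul A (t * ln (INR p) + b k).
set X := cos A; set Y := cos (_ + b k); set U := cos (A + _); set V := cos (A - _).
move=> h; transitivity (riesz b k t * X + riesz b k t * (X * Y)); last by ring.
by rewrite h; ring.
Qed.

Lemma has_mean_riesz_phase (b : nat -> R) (K j : nat) : (K <= j)%N ->
  has_mean (fun t => riesz b K t * cos (prime_phase b j t)) 0.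
Proof.
move=> Kj.
apply: has_mean_ext (has_mean_riesz_cos b K (nth_prime j) 1 j (b j) _ _ Kj _) => //.
- by move=> t; rewrite /prime_phase ln_1 Rminus_0_r [t * _]Rmult_comm.
- exact: nth_prime_gt0.
- by rewrite exponents_nth_prime eqxx /exponents logn1.
Qed.

(** Each new factor adds the earlier product times the cosine of a prime not yet used, which has
    mean 0. *)
Lemma has_mean_riesz (b : nat -> R) (K : nat) : has_mean (riesz b K) 1.
Proof.
elim: K => [|k IH]; first exact: has_mean_const.
rewrite -[1]Rplus_0_r.
apply: has_mean_ext (has_mean_plus _ _ _ _ IH (has_mean_riesz_phase b k k (leqnn k))).
by move=> t /=; ring.
Qed.

(** If [j] is the last factor, its squared cosine contributes 1/2 and the doubled frequency averages
    out. A later factor [k] only adds the frequencies ln p_k + ln p_j and ln p_k - ln p_j, which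
    have a nonzero valuation at [k] and so mean 0. *)
Lemma has_mean_riesz_phase_below (b : nat -> R) (K j : nat) : (j < K)%N ->
  has_mean (fun t => riesz b K t * cos (prime_phase b j t)) (/ 2).
Proof.
elim: K => [//|k IH]; rewrite ltnS leq_eqVlt => /orP[/eqP ->|jk].
  pose p := nth_prime k.
  have p0 : (0 < p)%N := nth_prime_gt0 k.
  have m3 := has_mean_riesz_cos b k (p * p) 1 k (2 * b k)
    ltac:(by rewrite muln_gt0 p0) isT (leqnn k)
    ltac:(by rewrite exponents_mul // exponents_nth_prime eqxx /exponents logn1).
  have := has_mean_plus _ _ _ _ (has_mean_riesz_phase b k k (leqnn k))
   (has_mean_plus _ _ _ _ (has_mean_scal _ _ (/ 2) (has_mean_riesz b k))
     (has_mean_scal _ _ (/ 2) m3)).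
  have -> : 0 + (/ 2 * 1 + / 2 * 0) = / 2 by lra.
  apply: has_mean_ext => t /=.
  rewrite -multE mult_INR ln_mult; [|exact: ltR0_INR|exact: ltR0_INR].
  rewrite ln_1.
  have -> : (ln (INR p) + ln (INR p) - 0) * t + 2 * b k =
    prime_phase b k t + prime_phase b k t by rewrite /prime_phase -/p; ring.
  have := cos_mul (prime_phase b k t) (prime_phase b k t).
  rewrite Rminus_diag cos_0.
  set X := cos (prime_phase b k t); set Y := cos (_ + _) => h.
  transitivity (riesz b k t * X + riesz b k t * (X * X)); last by ring.
  by rewrite h; ring.
have pj0 := nth_prime_gt0 j; have pk0 := nth_prime_gt0 k.
have kj : (k == j) = false by rewrite eq_sym ltn_eqF.
pose u := nth_prime k; pose v := nth_prime j.
have m2 := has_mean_riesz_cos b k (u * v) 1 k (b k + b j)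
  ltac:(by rewrite muln_gt0 pk0) isT (leqnn k)
  ltac:(by rewrite exponents_mul // !exponents_nth_prime eqxx kj /exponents logn1).
have m3 := has_mean_riesz_cos b k u v k (b k - b j) pk0 pj0 (leqnn k)
  ltac:(by rewrite !exponents_nth_prime eqxx kj).
have := has_mean_plus _ _ _ _ (IH jk)
   (has_mean_plus _ _ _ _ (has_mean_scal _ _ (/ 2) m2)
     (has_mean_scal _ _ (/ 2) m3)).
have -> : / 2 + (/ 2 * 0 + / 2 * 0) = / 2 by lra.
apply: has_mean_ext => t /=.
rewrite -multE mult_INR ln_mult; [|exact: ltR0_INR|exact: ltR0_INR].
rewrite ln_1.
have -> : (ln (INR u) + ln (INR v) - 0) * t + (b k + b j) =
  prime_phase b k t + prime_phase b j t by rewrite /prime_phase -/u -/v; ring.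
have -> : (ln (INR u) - ln (INR v)) * t + (b k - b j) =
  prime_phase b k t - prime_phase b j t by rewrite /prime_phase -/u -/v; ring.
have := cos_mul (prime_phase b k t) (prime_phase b j t).
set X := cos (prime_phase b k t); set Y := cos (prime_phase b j t).
set U := cos (_ + _); set V := cos (_ - _) => h.
transitivity (riesz b k t * Y + riesz b k t * (X * Y)); last by ring.
by rewrite h; ring.
Qed.

Lemma has_mean_riesz_sum (b a : nat -> R) (N : nat) :
  has_mean (fun t => riesz b N.+1 t *
      sum_n (fun k => a k * cos (prime_phase b k t)) N)
    (/ 2 * sum_n a N).
Proof.
(* The product keeps all its [N.+1] factors while the sum grows, so every index in the sum stays
   below [N.+1]. *)
suff H M : (M <= N)%N -> has_mean (fun t => riesz b N.+1 t *
      sum_n (fun k => a k * cos (prime_phase b k t)) M) (/ 2 * sum_n a M).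
  exact: H.
elim: M => [|M IH] MN.
  have m := has_mean_scal _ _ (a 0%N) (has_mean_riesz_phase_below b N.+1 0 isT).
  rewrite sum_O Rmult_comm.
  by apply: has_mean_ext m => t; rewrite sum_O; ring.
have m := has_mean_scal _ _ (a M.+1) (has_mean_riesz_phase_below b N.+1 M.+1 MN).
rewrite sum_SnR Rmult_plus_distr_l [/ 2 * a _]Rmult_comm.
apply: has_mean_ext (has_mean_plus _ _ _ _ (IH (ltnW MN)) m) => t.
by rewrite sum_SnR; ring.
Qed.

Lemma phase_sum_large (b a : nat -> R) (N : nat) (e : R) : 0 < e ->
  exists L, 0 < L /\ forall c, exists t, c < t < c + L /\
    / 2 * sum_n a N - e < sum_n (fun k => a k * cos (prime_phase b k t)) N.
Proof.
by apply: weighted_mean_large (riesz_ge0 b N.+1) (has_mean_riesz b N.+1)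
  (has_mean_riesz_sum b a N).
Qed.

(** * Series *)

Lemma sum_n_le_Series (c : nat -> R) (n : nat) :
  (forall k, 0 <= c k) -> ex_series c -> sum_n c n <= Series c.
Proof.
move=> c0 /Series_correct sc.
apply: (is_lim_seq_incr_compare (sum_n c)) => // k.
by rewrite sum_SnR; have := c0 k.+1; lra.
Qed.

Lemma Series_tail_lim (c : nat -> R) : ex_series c ->
  is_lim_seq (fun n => Series c - sum_n c n) 0.
Proof.
move=> /Series_correct sc; rewrite -(Rminus_diag (Series c)).
by apply: is_lim_seq_minus' sc; apply: is_lim_seq_const.
Qed.

Lemma Series_sub_sum_n_le (f c : nat -> R) (n : nat) :
  (forall k, Rabs (f k) <= c k) -> ex_series c ->
  Rabs (Series f - sum_n f n) <= Series c - sum_n c n.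
Proof.
move=> fc ec.
have eaf : ex_series (fun k => Rabs (f k)).
  by apply: ex_series_le ec => k; rewrite /norm /= /abs /= Rabs_Rabsolu.
have ef := ex_series_Rabs _ eaf.
have tail a : ex_series a -> Series a - sum_n a n = Series (fun k => a (n.+1 + k)%coq_nat).
  move=> ea; rewrite (Series_incr_n a n.+1) //; last exact/ltP.
  by rewrite sum_n_Reals /=; ring.
rewrite !tail //.
apply: Rle_trans (Series_Rabs _ _) _.
  exact: (proj1 (ex_series_incr_n (fun k => Rabs (f k)) n.+1)).
apply: Series_le; last exact: (proj1 (ex_series_incr_n c n.+1)).
by move=> k; split=> //; apply: Rabs_pos.
Qed.

Lemma continuous_sum_n (f : nat -> R -> R) (n : nat) (u : R) :
  (forall k, continuous (f k) u) -> continuous (fun v => sum_n (fun k => f k v) n) u.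
Proof.
move=> cf; elim: n => [|n IH].
  by apply: (continuous_ext (f 0%N)) => // v; rewrite sum_O.
apply: (continuous_ext (fun v => plus (sum_n (fun k => f k v) n) (f n.+1 v))) => [v|].
  by rewrite sum_Sn.
exact: continuous_plus.
Qed.

(** Weierstrass M-test, with the majorant asked for only near [u]: the series in [s] met below get
    summable majorants only away from s = 1. *)
Lemma continuous_Series (f : nat -> R -> R) (c : nat -> R) (u : R) :
  locally u (fun v => forall k, Rabs (f k v) <= c k) -> ex_series c ->
  (forall k, continuous (f k) u) -> continuous (fun v => Series (fun k => f k v)) u.
Proof.
move=> fc ec cf; apply/filterlim_locally => eps.
have e3 : 0 < eps / 3 by have := cond_pos eps; lra.
have /is_lim_seq_spec/(_ (mkposreal _ e3)) [n /(_ n (Nat.le_refl n)) /= tn] := Series_tail_lim c ec.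
rewrite Rminus_0_r in tn.
have sn : locally u (fun v => Rabs (sum_n (fun k => f k v) n - sum_n (fun k => f k u) n) < eps / 3).
  have /filterlim_locally/(_ (mkposreal _ e3)) := continuous_sum_n f n u cf.
  by [].
have fu := locally_singleton _ _ fc.
apply: filter_imp (filter_and _ _ fc sn) => v [fv sv].
rewrite /ball /= /AbsRing_ball /abs /minus /plus /opp /=.
have hu := Series_sub_sum_n_le _ _ n fu ec.
have hv := Series_sub_sum_n_le _ _ n fv ec.
move: hu hv sv tn => /Rabs_le_between hu /Rabs_le_between hv.
move=> /Rabs_lt_between sv /Rabs_lt_between tn.
apply: Rabs_def1; lra.
Qed.

(** * Real powers, the p-series and the harmonic sum *)

Lemma Rpower_neg_pos (a s : R) : 0 < Rpower a (- s).
Proof. exact: exp_pos. Qed.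

Lemma ln_le_sub1 (x : R) : 0 < x -> ln x <= x - 1.
Proof. by move=> x0; have := exp_ineq1_le (ln x); rewrite exp_ln //; lra. Qed.

Lemma INRS_gt0 (n : nat) : 0 < INR n.+1.
Proof. exact: ltR0_INR. Qed.

(** Both bounds are [ln y <= y - 1], at the quotient of the two integers and at its inverse. *)
Lemma ln_succ_bounds (n : nat) :
  / INR n.+2 <= ln (INR n.+2) - ln (INR n.+1) <= / INR n.+1.
Proof.
have a0 := INRS_gt0 n; have b0 := INRS_gt0 n.+1.
have E : INR n.+2 = INR n.+1 + 1 by rewrite S_INR.
have h1 := ln_le_sub1 (INR n.+2 / INR n.+1) (Rdiv_lt_0_compat _ _ b0 a0).
have h2 := ln_le_sub1 (INR n.+1 / INR n.+2) (Rdiv_lt_0_compat _ _ a0 b0).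
rewrite ln_div // in h1; rewrite ln_div // in h2.
have e1 : INR n.+2 / INR n.+1 - 1 = / INR n.+1 by rewrite E; field; lra.
have e2 : INR n.+1 / INR n.+2 - 1 = - / INR n.+2 by rewrite E; field; lra.
lra.
Qed.

(** Integral-test comparison: with [a = s - 1], each term after the first, times [a], is at most the
    drop of n^(-a) over one step, and the drops telescope. *)
Lemma ex_series_Rpower (s : R) : 1 < s -> ex_series (fun n => Rpower (INR n.+1) (- s)).
Proof.
move=> s1; pose a := s - 1.
have a0 : 0 < a by rewrite /a; lra.
have step n : a * Rpower (INR n.+2) (- s) <=
    Rpower (INR n.+1) (- a) - Rpower (INR n.+2) (- a).
  have y0 := INRS_gt0 n.+1.
  have [h _] := ln_succ_bounds n.
  have -> : Rpower (INR n.+2) (- s) = Rpower (INR n.+2) (- a) * / INR n.+2.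
    by rewrite /Rpower -[X in _ * / X](exp_ln _ y0) -exp_Ropp -exp_plus /a; congr exp; ring.
  have -> : Rpower (INR n.+1) (- a) =
      Rpower (INR n.+2) (- a) * exp (a * (ln (INR n.+2) - ln (INR n.+1))).
    by rewrite /Rpower -exp_plus; congr exp; ring.
  have := exp_ineq1_le (a * (ln (INR n.+2) - ln (INR n.+1))).
  have := Rpower_neg_pos (INR n.+2) a.
  set X := Rpower _ _; set Y := exp _; set i := / _ in h *; set d := _ - _ in h *.
  move=> X0 Yd.
  have : a * i <= a * d by apply: Rmult_le_compat_l; lra.
  move=> aid; have : X * (1 + a * i) <= X * Y by apply: Rmult_le_compat_l; lra.
  lra.
(* The first term has no preceding drop and accounts for the summand [a]. *)
have bnd n : a * sum_n (fun n => Rpower (INR n.+1) (- s)) n <=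
    a + 1 - Rpower (INR n.+1) (- a).
  elim: n => [|n IH].
    by rewrite sum_O /= /Rpower ln_1 !Rmult_0_r exp_0; lra.
  by rewrite sum_SnR Rmult_plus_distr_l; have := step n; lra.
suff [l Hl] : ex_finite_lim_seq (sum_n (fun n => Rpower (INR n.+1) (- s))) by exists l.
apply: (ex_finite_lim_seq_incr _ ((a + 1) / a)) => n.
  by rewrite sum_SnR; have := Rpower_neg_pos (INR n.+2) s; lra.
apply/Rle_div_r => //; rewrite Rmult_comm.
by have := bnd n; have := Rpower_neg_pos (INR n.+1) a; lra.
Qed.

Lemma harmonic_sum_ge (n : nat) : ln (INR n.+2) <= sum_n (fun k => / INR k.+1) n.
Proof.
elim: n => [|n IH].
  rewrite sum_O; have [_] := ln_succ_bounds 0; rewrite /= ln_1; lra.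
by rewrite sum_SnR; have [_] := ln_succ_bounds n.+1; lra.
Qed.

(** * The Euler product as a sieve *)

(** Excluding 0 from the start makes sums over all n agree with the series over n >= 1, whatever
    [f 0] is. *)
Fixpoint sifted (K n : nat) : bool :=
  if K is k.+1 then sifted k n && ~~ (nth_prime k %| n)%N else (0 < n)%N.

(** The factors are those of the reciprocal of the Dirichlet series, so no inverse has to be
    taken. *)
Fixpoint euler_prod (f : nat -> C) (K : nat) : C :=
  if K is k.+1 then (euler_prod f k * (1 - f (nth_prime k)))%C else RtoC 1.

Lemma euler_prodS (f : nat -> C) (K : nat) :
  euler_prod f K.+1 = (euler_prod f K * (1 - f (nth_prime K)))%C.
Proof. by []. Qed.

Lemma sifted_gt0 (K n : nat) : sifted K n -> (0 < n)%N.
Proof. by elim: K => [//|K IH] /= /andP[/IH]. Qed.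

Lemma sifted1 (K : nat) : sifted K 1.
Proof.
elim: K => [//|K IH] /=; rewrite IH dvdn1 /=.
by rewrite neq_ltn orbC; have := prime_gt1 (prime_nth_prime K) => ->.
Qed.

Lemma sifted_not_dvd (K n j : nat) : sifted K n -> (j < K)%N -> ~~ (nth_prime j %| n)%N.
Proof.
elim: K => [//|K IH] /= /andP[sn nK]; rewrite ltnS leq_eqVlt.
by case/orP=> [/eqP ->|/IH]; last exact.
Qed.

(** The least prime factor of [n] is none of the first [K] primes, and these include every prime up
    to [K]. *)
Lemma sifted_gt (K n : nat) : sifted K n -> (1 < n)%N -> (K < n)%N.
Proof.
move=> sn n1; have n0 := ltnW n1.
apply: leq_trans (pdiv_leq n0); rewrite ltnNge; apply/negP => pK.
have [|j jK E] := prime_below_nth K (pdiv n) (pdiv_prime n1).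
  by apply: leq_ltn_trans pK _; apply: ltnW (nth_prime_lower K).
by have := sifted_not_dvd K n j sn jK; rewrite -E pdiv_dvd.
Qed.

Lemma sifted_mul_prime (K n : nat) : sifted K (nth_prime K * n) = sifted K n.
Proof.
suff H k : (k <= K)%N -> sifted k (nth_prime K * n) = sifted k n by exact: H.
elim: k => [|k IH] kK /=; first by rewrite muln_gt0 nth_prime_gt0.
rewrite IH ?(ltnW kK) // Euclid_dvdM ?prime_nth_prime //.
by rewrite dvdn_prime2 ?prime_nth_prime // nth_prime_inj ltn_eqF.
Qed.

(** The partial sum of [h] up to [M] only sees multiples of [p], so it is the partial sum up to
    [M %/ p] of the reindexed series. *)
Lemma is_series_multiples (h : nat -> C) (p : nat) (S : C) : (0 < p)%N ->
  (forall m, ~~ (p %| m)%N -> h m = RtoC 0) ->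
  is_series (V := C_NormedModule) (fun n => h (p * n)%N) S ->
  is_series (V := C_NormedModule) h S.
Proof.
move=> p0 h0 hS.
have E M : sum_n (G := C_AbelianMonoid) (fun n => h (p * n)%N) (M %/ p) =
           sum_n (G := C_AbelianMonoid) h M.
  elim: M => [|M IH]; first by rewrite div0n !sum_O muln0.
  rewrite divnS // [RHS]sum_Sn -IH.
  case: (boolP (p %| M.+1)%N) => pM.
    rewrite sum_Sn; congr (plus _ (h _)).
    have := divnS M p0; rewrite pM add1n => <-.
    by rewrite mulnC divnK.
  by rewrite (h0 _ pM) add0n; symmetry; apply: plus_zero_r.
apply: filterlim_ext E _.
apply: filterlim_comp hS => P [N HN]; exists (p * N)%N => M /leP NM.
by apply: HN; apply/leP; rewrite leq_divRL // mulnC.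
Qed.

(** The sieve of Eratosthenes on a series: by multiplicativity, [f p] times the sifted series is its
    part over the multiples of [p], and removing that part multiplies the sum by [1 - f p]. *)
Lemma is_series_sifted (f : nat -> C) (S : C) (K : nat) :
  (forall k n, (0 < n)%N -> f (nth_prime k * n)%N = (f (nth_prime k) * f n)%C) ->
  is_series (V := C_NormedModule) (fun n => f n.+1) S ->
  is_series (V := C_NormedModule) (fun n => if sifted K n then f n else RtoC 0)
    (S * euler_prod f K)%C.
Proof.
move=> fM fS; elim: K => [|K IH].
  (* The sifted series starts at index 0, where its term is 0. *)
  apply: is_series_decr_1 => /=.
  suff -> : plus (S * 1)%C (opp (RtoC 0)) = S by [].
  by rewrite /plus /opp /=; ring.
pose p := nth_prime K.
have p0 : (0 < p)%N := nth_prime_gt0 K.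
pose h m := if sifted K m && (p %| m)%N then f m else RtoC 0.
have hS : is_series (V := C_NormedModule) h (f p * (S * euler_prod f K))%C.
  apply: (is_series_multiples h p) => // [m /negbTE pm|].
    by rewrite /h pm andbF.
  apply: is_series_ext (is_series_scal (V := C_NormedModule) (f p) _ _ IH) => n.
  rewrite /h sifted_mul_prime dvdn_mulr // andbT /scal /=.
  case: (boolP (sifted K n)) => [sn|_]; last by rewrite /mult /=; ring.
  by rewrite fM // (sifted_gt0 K).
have -> : (S * euler_prod f K.+1)%C =
    minus (G := C_AbelianGroup) (S * euler_prod f K)%C (f p * (S * euler_prod f K))%C.
  by rewrite /= -/p /minus /plus /opp /=; ring.
apply: is_series_ext (is_series_minus _ _ _ _ IH hS) => n; rewrite /h /= -/p.
by case: (sifted K n); case: (p %| n)%N => /=; rewrite /minus /plus /opp /=; ring.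
Qed.

(** Meant for partial sums compared with 1; index 1 is the first at which they contain the term
    1. *)
Lemma Cmod_lim_le (s : nat -> C) (w z : C) (T : R) :
  filterlim s eventually (locally (T := C_UniformSpace) w) ->
  (forall n, (1 <= n)%N -> Cmod (s n - z)%C <= T) -> Cmod (w - z)%C <= T.
Proof.
move=> sw sT.
have L : is_lim_seq (fun n => Cmod (s n - z)%C) (Cmod (w - z)%C).
  apply: (filterlim_comp _ _ _ (fun n => minus (s n : C_NormedModule) z) norm _ _ _ _
    (filterlim_norm _)).
  have cz : filterlim (fun _ : nat => opp (z : C_NormedModule)) eventually
      (locally (opp (z : C_NormedModule))) by exact: filterlim_const.
  apply: (filterlim_comp_2 (G := locally (T := C_NormedModule) w)
    (H := locally (opp (z : C_NormedModule))) _ (fun _ => opp (z : C_NormedModule)) plus sw cz).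
  exact: (filterlim_plus (V := C_NormedModule) w (opp z)).
apply: (is_lim_seq_le_loc _ _ _ _ _ L (is_lim_seq_const T)).
by exists 1%N => n /leP; apply: sT.
Qed.

(** Besides n = 1 only n > K survive sifting by the first [K] primes, so the distance to 1 is at
    most the tail beyond [K] of the series of absolute values. *)
Lemma euler_prod_lim (f : nat -> C) (S : C) :
  f 1%N = RtoC 1 ->
  (forall k n, (0 < n)%N -> f (nth_prime k * n)%N = (f (nth_prime k) * f n)%C) ->
  is_series (V := C_NormedModule) (fun n => f n.+1) S ->
  ex_series (fun n => Cmod (f n.+1)) ->
  is_lim_seq (fun K => Cmod (S * euler_prod f K - 1)%C) 0.
Proof.
move=> f1 fM fS fa.
pose c n := Cmod (f n).
have c0 n : 0 <= c n by apply: Cmod_ge_0.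
have ec : ex_series c by apply/ex_series_incr_1.
apply: (is_lim_seq_le_le (fun _ => 0) _ (fun K => Series c - sum_n c K))
  (is_lim_seq_const 0) (Series_tail_lim c ec) => K.
split; first exact: Cmod_ge_0.
apply: Cmod_lim_le (is_series_sifted f S K fM fS) _ => N N1.
pose g n := if sifted K n then f n else RtoC 0.
(* The maximum covers partial sums that have not passed [K]: there only the term at 1 has occurred
   and the distance is 0. *)
have B M : Cmod (sum_n (G := C_AbelianMonoid) g M.+1 - 1)%C + sum_n c K <= sum_n c (maxn M.+1 K).
  elim: M => [|M IH].
    rewrite sum_Sn sum_O /g sifted1 f1.
    have -> : sifted K 0 = false by apply: contraTF isT => /sifted_gt0.
    have -> : (plus (RtoC 0) (RtoC 1) - 1)%C = RtoC 0 by rewrite /plus /=; ring.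
    rewrite Cmod_0 Rplus_0_l.
    case: (posnP K) => [->|K0]; last by rewrite (maxn_idPr K0); lra.
    by rewrite maxn0 sum_SnR; have := c0 1%N; lra.
  rewrite sum_Sn.
  set s := sum_n g M.+1 in IH *.
  case: (boolP (sifted K M.+2)) => sM.
    have KM := sifted_gt K M.+2 sM isT.
    rewrite (maxn_idPl _) ?(ltnW KM) // sum_SnR; rewrite (maxn_idPl _) // in IH.
    have -> : (plus s (g M.+2) - 1)%C = ((s - 1) + g M.+2)%C by rewrite /plus /=; ring.
    have := Cmod_triangle (s - 1)%C (g M.+2).
    have -> : Cmod (g M.+2) = c M.+2 by rewrite /g sM.
    lra.
  have -> : (plus s (g M.+2) - 1)%C = (s - 1)%C.
    by rewrite /g (negbTE sM) /plus /=; ring.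
  apply: Rle_trans IH _.
  case: (leqP M.+2 K) => KM.
    by rewrite (maxn_idPr (ltnW KM)); lra.
  rewrite (maxn_idPl _) // [X in _ <= X]sum_SnR.
  by have := c0 M.+2; lra.
have := B N.-1; rewrite (prednK N1) => BN.
have mS := sum_n_le_Series c (maxn N K) c0 ec.
change (Cmod (sum_n (G := C_AbelianMonoid) g N - 1)%C <= Series c - sum_n c K); lra.
Qed.

(** * Prime powers and the divergence of their sum at s = 1 *)

Lemma exp_le (a b : R) : a <= b -> exp a <= exp b.
Proof.
by case=> [/exp_increasing|->]; [apply: Rlt_le|apply: Rle_refl].
Qed.

Lemma Rpower_neg_antitone (a s s' : R) : 1 <= a -> s <= s' ->
  Rpower a (- s') <= Rpower a (- s).
Proof.
move=> a1 ss; apply: exp_le.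
have : 0 <= ln a by rewrite -ln_1; apply: ln_le; lra.
nra.
Qed.

Lemma Rpower_base_antitone (a b s : R) : 0 < a -> a <= b -> 0 <= s ->
  Rpower b (- s) <= Rpower a (- s).
Proof.
move=> a0 ab s0; apply: exp_le.
by have := ln_le a b a0 ab; nra.
Qed.

Lemma Rpower_neg1 (a : R) : 0 < a -> Rpower a (- 1) = / a.
Proof. by move=> a0; rewrite Rpower_Ropp Rpower_1. Qed.

Lemma leq_INR (m n : nat) : (m <= n)%N -> INR m <= INR n.
Proof. by move=> /leP /le_INR. Qed.

Definition prime_pow (s : R) (k : nat) : R := Rpower (INR (nth_prime k)) (- s).

Lemma prime_pow_gt0 (s : R) (k : nat) : 0 < prime_pow s k.
Proof. exact: exp_pos. Qed.

Lemma prime_pow_le (s : R) (k : nat) : 0 <= s ->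
  prime_pow s k <= Rpower (INR k.+1) (- s).
Proof.
move=> s0; apply: Rpower_base_antitone => //; first exact: INRS_gt0.
by apply: leq_INR; apply: ltnW (nth_prime_lower k).
Qed.

Lemma prime_pow_le_half (s : R) (k : nat) : 1 <= s -> prime_pow s k <= / 2.
Proof.
move=> s1; have p2 : 2 <= INR (nth_prime k) := leq_INR 2 _ (prime_gt1 (prime_nth_prime k)).
apply: Rle_trans (Rpower_neg_antitone _ 1 s _ s1) _; first by lra.
by rewrite Rpower_neg1; [apply: Rinv_le_contravar; lra|lra].
Qed.

(** For r <= 1/2 the inverse of [1 - r] is at most [1 + 2 * r], hence at most [exp (2 * r)]. *)
Lemma exp_le_one_sub (r : R) : 0 <= r <= / 2 -> exp (- (2 * r)) <= 1 - r.
Proof.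
move=> r2; rewrite exp_Ropp -[1 - r]Rinv_inv; apply: Rinv_le_contravar.
  by apply: Rinv_0_lt_compat; lra.
apply: Rle_trans (exp_ineq1_le (2 * r)).
by rewrite -[/ _]Rmult_1_l; apply/Rle_div_l; [lra|nra].
Qed.

(** Euler's argument made quantitative: a prime sum below [A] would keep the product of 1 - p^(-s)
    above exp (-2 A); times a sum over n of at least 2 exp (2 A), it could not come within distance
    less than 1 of 1. *)
Lemma prime_sum_large (A s0 : R) : 1 < s0 ->
  exists s, 1 < s < s0 /\ exists N0, forall N, (N0 <= N)%N ->
    A <= sum_n (prime_pow s) N.
Proof.
move=> s01.
(* The summand 1 is what the truncated sum may lose when the exponent moves from 1 to [s]. *)
have [M HM] : exists M, 2 * exp (2 * A) + 1 <= ln (INR M.+2).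
  have [M HM] := INR_unbounded (exp (2 * exp (2 * A) + 1)).
  exists M; rewrite -[X in X <= _]ln_exp; apply: ln_le; first exact: exp_pos.
  by rewrite !S_INR; lra.
pose H s := sum_n (fun k => Rpower (INR k.+1) (- s)) M.
have H1 : ln (INR M.+2) <= H 1.
  apply: Rle_trans (harmonic_sum_ge M) _; apply: Req_le.
  by apply: sum_n_ext => k; rewrite Rpower_neg1 //; exact: INRS_gt0.
have cH : continuous H 1.
  apply: (continuous_sum_n (fun k s => Rpower (INR k.+1) (- s))) => k.
  by apply: ex_derive_continuous; rewrite /Rpower; auto_derive.
have [d Hd] : locally 1 (fun s => Rabs (H s - H 1) < 1).
  by have /filterlim_locally/(_ (mkposreal _ Rlt_0_1)) := cH.
have d0 := cond_pos d.
(* The first bound keeps [H s] within 1 of [H 1], the second keeps [s] below [s0]. *)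
pose s := 1 + Rmin (d / 2) ((s0 - 1) / 2).
have m1 := Rmin_l (d / 2) ((s0 - 1) / 2); have m2 := Rmin_r (d / 2) ((s0 - 1) / 2).
have m0 : 0 < Rmin (d / 2) ((s0 - 1) / 2) by apply: Rmin_pos; lra.
have s1 : 1 < s < s0 by rewrite /s; lra.
exists s; split=> //.
have Hs : 2 * exp (2 * A) <= H s.
  have : ball 1 d s.
    rewrite /ball /= /AbsRing_ball /abs /minus /plus /opp /= /s.
    by apply: Rabs_def1; lra.
  by move=> /Hd/Rabs_lt_between; lra.
pose f n := RtoC (Rpower (INR n) (- s)).
have ec := ex_series_Rpower s (proj1 s1).
have [Z ZE] : exists Z, Z = Series (fun n => Rpower (INR n.+1) (- s)) by eexists.
have fa n : Cmod (f n) = Rpower (INR n) (- s).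
  by rewrite Cmod_R Rabs_pos_eq //; apply/Rlt_le/exp_pos.
have ef : ex_series (V := C_NormedModule) (fun n => f n.+1).
  apply: (ex_series_le (V := C_CompleteNormedModule) _ _ _ ec) => n.
  by change (Cmod (f n.+1) <= Rpower (INR n.+1) (- s)); rewrite fa; lra.
case: ef => S fS.
have fM k n : (0 < n)%N -> f (nth_prime k * n)%N = (f (nth_prime k) * f n)%C.
  move=> n0; rewrite /f -multE mult_INR -RtoC_mult; congr RtoC.
  by rewrite Rpower_mult_distr //; apply: ltR0_INR => //; apply: nth_prime_gt0.
have lim := euler_prod_lim f S _ fM fS _.
have {lim}/is_lim_seq_spec/(_ (mkposreal _ Rlt_0_1)) [N0 HN0] :
    is_lim_seq (fun K => Cmod (S * euler_prod f K - 1)%C) 0.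
  apply: lim; first by rewrite /f /= /Rpower ln_1 Rmult_0_r exp_0.
  by apply: ex_series_ext ec => n; rewrite fa.
have HS : H s <= Cmod S.
  have L : is_lim_seq (fun n => Cmod (sum_n (G := C_AbelianMonoid) (fun n => f n.+1) n)) (Cmod S).
    exact: (filterlim_comp _ _ _ _ (norm (V := C_NormedModule)) _ _ _ fS (filterlim_norm _)).
  apply: (is_lim_seq_le_loc (fun _ => H s) _ _ (Cmod S) _ (is_lim_seq_const _) L).
  exists M => n /leP Mn.
  have -> : sum_n (G := C_AbelianMonoid) (fun n => f n.+1) n =
      RtoC (sum_n (fun k => Rpower (INR k.+1) (- s)) n).
    elim: n {Mn} => [|n IH]; first by rewrite !sum_O.
    by rewrite sum_Sn sum_SnR IH RtoC_plus.
  rewrite Cmod_R; apply: Rle_trans (Rle_abs _).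
  rewrite -(subnKC Mn); elim: (n - M)%N => [|j IH]; first by rewrite addn0; apply: Rle_refl.
  by rewrite addnS sum_SnR; have := Rpower_neg_pos (INR (M + j).+2) s; lra.
have E K : exp (- (2 * sum_n (prime_pow s) K)) <= Cmod (euler_prod f K.+1).
  have fac k : exp (- (2 * prime_pow s k)) <= Cmod (1 - f (nth_prime k))%C.
    apply: Rle_trans (exp_le_one_sub _ _) _.
      by split; [apply/Rlt_le/prime_pow_gt0|apply: prime_pow_le_half; lra].
    by rewrite -RtoC_minus Cmod_R; apply: Rle_abs.
  elim: K => [|K IH].
    by rewrite sum_O /= Cmult_1_l; apply: fac.
  rewrite sum_SnR; set K1 := K.+1 in IH *; rewrite /= Cmod_mult.
  have -> : - (2 * (sum_n (prime_pow s) K + prime_pow s K1)) =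
    - (2 * sum_n (prime_pow s) K) + - (2 * prime_pow s K1) by ring.
  by rewrite exp_plus; apply: Rmult_le_compat => //; apply/Rlt_le/exp_pos.
exists N0 => N NN; apply: Rnot_lt_le => lt.
have /= := HN0 N.+1 ltac:(by apply/leP; apply: leqW).
rewrite Rminus_0_r Rabs_pos_eq; last exact: Cmod_ge_0.
apply: Rle_not_lt.
have : exp (- (2 * A)) < Cmod (euler_prod f N.+1).
  by apply: Rlt_le_trans (E N); apply: exp_increasing; lra.
have ee : exp (2 * A) * exp (- (2 * A)) = 1 by rewrite -exp_plus Rplus_opp_r exp_0.
have e0 := exp_pos (2 * A); have e0' := exp_pos (- (2 * A)).
have tri := Cmod_triangle (S * euler_prod f N.+1 - 1)%C 1%C.
move: tri.
have -> : (S * euler_prod f N.+1 - 1 + 1)%C = (S * euler_prod f N.+1)%C by ring.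
rewrite Cmod_mult Cmod_1.
set P := Cmod (euler_prod _ _); set W := Cmod S in HS *; set V := Cmod _ => tri h.
have : 2 * exp (2 * A) * exp (- (2 * A)) <= W * P.
  by apply: Rmult_le_compat; lra.
lra.
Qed.

(** * Polar form and the argument of zeta *)

Definition polar (r a : R) : C := (r * cos a, r * sin a).

Lemma polar_mul (r a q b : R) : (polar r a * polar q b)%C = polar (r * q) (a + b).
Proof.
by rewrite /polar /Cmult /= cos_plus sin_plus; congr (_, _); ring.
Qed.

Lemma Cmod_polar (r a : R) : 0 <= r -> Cmod (polar r a) = r.
Proof.
move=> r0; rewrite /Cmod /=.
have -> : r * cos a * (r * cos a * 1) + r * sin a * (r * sin a * 1) = Rsqr r.
  have := sin2_cos2 a; rewrite /Rsqr => h.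
  transitivity (r * r * (sin a * sin a + cos a * cos a)); first by ring.
  by rewrite h Rmult_1_r.
exact: sqrt_Rsqr.
Qed.

Lemma Cexp_polar (z : C) : Cexp z = polar (exp (Re z)) (Im z).
Proof. by []. Qed.

Lemma zeta_term_polar (x : nat -> R) (s t : R) (n : nat) :
  zeta_term x (RtoC s + Ci * RtoC t)%C n =
  polar (Rpower (INR n) (- s)) (exponents_dot n x - t * ln (INR n)).
Proof.
rewrite /zeta_term /nat_Cpow !Cexp_polar.
set q := exp (Re (_ * RtoC (ln _))%C).
have q0 : 0 < q by apply: exp_pos.
rewrite /Cdiv; set d := polar (exp _) _; set w := polar q _.
have w0 : w <> RtoC 0.
  have : Cmod w = q by apply: Cmod_polar; lra.
  by move=> h w0; move: h; rewrite w0 Cmod_0; lra.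
suff -> : d = (polar (Rpower (INR n) (- s)) (exponents_dot n x - t * ln (INR n)) * w)%C.
  by rewrite -Cmult_assoc Cinv_r // Cmult_1_r.
rewrite /w polar_mul /d /q /Rpower -exp_plus.
rewrite /Re /Im /Ci /RtoC /Cmult /Cplus /=.
by congr (polar (exp _) _); ring.
Qed.

(** The principal argument of the inverse of 1 - r e^(i a), when the real part [1 - r * cos a] is
    positive. *)
Definition arg_factor (r a : R) : R := atan (r * sin a / (1 - r * cos a)).

Lemma polar_half_bounds (r a : R) : 0 <= r <= / 2 -> / 2 <= 1 - r * cos a.
Proof. by move=> r2; have := COS_bound a; nra. Qed.

Lemma one_sub_polar (r a : R) : 0 <= r <= / 2 ->
  (1 - polar r a)%C = polar (Cmod (1 - polar r a)) (- arg_factor r a).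
Proof.
move=> r2; have X0 := polar_half_bounds r a r2.
rewrite /polar /arg_factor /Cmod /= cos_neg sin_neg cos_atan sin_atan.
set X := 1 - r * cos a in X0 *; set Y := r * sin a.
have -> : sqrt (1 + (Y / X)²) = sqrt (X * X + Y * Y) / X.
  have -> : 1 + (Y / X)² = (X * X + Y * Y) / X².
    by rewrite /Rsqr; field; lra.
  rewrite sqrt_div_alt; last by rewrite /Rsqr; nra.
  by rewrite sqrt_Rsqr //; lra.
rewrite /Cminus /Cplus /Copp /= -/Y.
have -> : (1 + - (r * cos a)) = X by [].
have -> : X * (X * 1) + (0 + - Y) * ((0 + - Y) * 1) = X * X + Y * Y by ring.
have S0 : 0 < sqrt (X * X + Y * Y) by apply: sqrt_lt_R0; nra.
by congr (_, _); field; lra.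
Qed.

(** By the mean value theorem [atan u] is u / (1 + c^2) with c between 0 and [u]; a quadratic error
    is enough, since squares of prime powers are summable down to s = 1. *)
Lemma atan_dist (u : R) : Rabs (atan u - u) <= u ^ 2 /\ Rabs (atan u) <= Rabs u.
Proof.
have [c [hc cu]] : exists c, atan u = / (1 + c ^ 2) * u /\ Rabs c <= Rabs u.
  have [||c [cu E]] := MVT_gen atan 0 u (fun c => / (1 + c ^ 2)).
  - by move=> c _; apply/is_derive_Reals; apply: derivable_pt_lim_atan.
  - by move=> c _; apply: derivable_continuous_pt; apply: derivable_pt_atan.
  exists c; split; first by move: E; rewrite atan_0; lra.
  move: cu; rewrite /Rmin /Rmax; case: Rle_dec => u0 cu.
    by rewrite !Rabs_pos_eq; lra.
  by rewrite !Rabs_left1; lra.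
have c2 : 0 <= c ^ 2 by apply: pow2_ge_0.
have c2u : c ^ 2 <= u ^ 2.
  rewrite -[c ^ 2]pow2_abs -[u ^ 2]pow2_abs; apply: pow_incr.
  by split=> //; apply: Rabs_pos.
have i0 : 0 < / (1 + c ^ 2) by apply: Rinv_0_lt_compat; lra.
have i1 : / (1 + c ^ 2) <= 1 by rewrite -Rinv_1; apply: Rinv_le_contravar; lra.
split; last first.
  by rewrite hc Rabs_mult (Rabs_pos_eq (/ _)); [have := Rabs_pos u; nra|lra].
have -> : atan u - u = - (c * / (1 + c ^ 2)) * (c * u).
  by rewrite hc; field; lra.
have ci : Rabs (c * / (1 + c ^ 2)) <= 1.
  rewrite Rabs_mult (Rabs_pos_eq (/ _)); last lra.
  have -> : c ^ 2 = Rabs c ^ 2 by rewrite pow2_abs.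
  by apply/Rle_div_l; have := Rabs_pos c; nra.
rewrite Rabs_mult Rabs_Ropp [Rabs (c * u)]Rabs_mult -[u ^ 2]pow2_abs.
have h : Rabs c * Rabs u <= Rabs u ^ 2 by have := Rabs_pos u; nra.
have p0 : 0 <= Rabs c * Rabs u by apply: Rmult_le_pos; apply: Rabs_pos.
have := Rabs_pos (c * / (1 + c ^ 2)); nra.
Qed.

(** The denominator is at least 1/2, so the quotient [u] is at most 2 r in size. Replacing [atan u]
    by [u] costs 4 r^2, and [u] by [r * sin a] another 2 r^2. *)
Lemma arg_factor_bounds (r a : R) : 0 <= r <= / 2 ->
  Rabs (arg_factor r a) <= 2 * r /\ Rabs (arg_factor r a - r * sin a) <= 6 * r ^ 2.
Proof.
move=> r2; have X0 := polar_half_bounds r a r2.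
pose u := r * sin a / (1 - r * cos a).
have sb := SIN_bound a; have cb := COS_bound a.
have i2 : 0 < / (1 - r * cos a) <= 2.
  split; first by apply: Rinv_0_lt_compat; lra.
  by rewrite -[2]Rinv_inv; apply: Rinv_le_contravar; lra.
have rs : Rabs (r * sin a) <= r by apply: Rabs_le; nra.
have ub : Rabs u <= 2 * r.
  rewrite /u /Rdiv Rabs_mult (Rabs_pos_eq (/ _)); last lra.
  by have := Rabs_pos (r * sin a); nra.
have ur : Rabs (u - r * sin a) <= 2 * r ^ 2.
  have -> : u - r * sin a = (r * sin a) * (r * cos a) * / (1 - r * cos a).
    by rewrite /u; field; lra.
  rewrite !Rabs_mult (Rabs_pos_eq (/ _)); last lra.
  have rc : Rabs r * Rabs (cos a) <= r by rewrite -Rabs_mult; apply: Rabs_le; nra.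
  rewrite Rabs_mult in rs.
  have A0 : 0 <= Rabs r * Rabs (cos a) by apply: Rmult_le_pos; apply: Rabs_pos.
  have B0 : 0 <= Rabs r * Rabs (sin a) by apply: Rmult_le_pos; apply: Rabs_pos.
  set p := Rabs r * Rabs (cos a) in rc A0 *; set q := Rabs r * Rabs (sin a) in rs B0 *.
  have : q * p <= r * r by apply: Rmult_le_compat.
  have : 0 <= q * p by apply: Rmult_le_pos.
  nra.
have [h1 h2] := atan_dist u; rewrite /arg_factor -/u; split; first by lra.
have u2 : u ^ 2 <= 4 * r ^ 2.
  by rewrite -pow2_abs; have := Rabs_pos u; nra.
have -> : atan u - r * sin a = (atan u - u) + (u - r * sin a) by ring.
apply: Rle_trans (Rabs_triang _ _) _; lra.
Qed.

(** * The argument series and its continuity *)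

Definition prime_angle (x : nat -> R) (t : R) (k : nat) : R :=
  x k - t * ln (INR (nth_prime k)).

Definition zeta_arg (x : nat -> R) (t s : R) : R :=
  Series (fun k => arg_factor (prime_pow s k) (prime_angle x t k)).

(** The exponent [s0] may lie below [s], so that one majorant serves a whole neighbourhood in the
    M-test. *)
Lemma arg_factor_prime_le (x : nat -> R) (t s s0 : R) (k : nat) :
  1 <= s0 -> s0 <= s ->
  Rabs (arg_factor (prime_pow s k) (prime_angle x t k)) <=
  2 * Rpower (INR k.+1) (- s0).
Proof.
move=> s01 ss.
have h := prime_pow_le_half s k ltac:(lra); have p0 := prime_pow_gt0 s k.
have [b _] := arg_factor_bounds _ (prime_angle x t k) (conj (Rlt_le _ _ p0) h).
apply: Rle_trans b _; apply: Rmult_le_compat_l; first by lra.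
apply: Rle_trans (prime_pow_le s k ltac:(lra)) _.
by apply: Rpower_neg_antitone => //; exact: (leq_INR 1 k.+1 isT).
Qed.

Lemma ex_series_arg_bound (s : R) : 1 < s ->
  ex_series (fun k => 2 * Rpower (INR k.+1) (- s)).
Proof.
move=> s1; exact: (ex_series_scal_l (V := R_NormedModule) 2 _ (ex_series_Rpower s s1)).
Qed.

(** The midpoint of 1 and [s] is a common exponent, still above 1, for the majorants near [s]. *)
Lemma near_above_one (s : R) : 1 < s -> locally s (fun v => (1 + s) / 2 <= v).
Proof.
move=> s1; have d0 : 0 < (s - 1) / 2 by lra.
exists (mkposreal _ d0) => v.
rewrite /ball /= /AbsRing_ball /abs /minus /plus /opp /= => /Rabs_lt_between; lra.
Qed.

Lemma continuous_zeta_arg (x : nat -> R) (t s : R) : 1 < s ->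
  continuous (zeta_arg x t) s.
Proof.
move=> s1.
apply: (continuous_Series _ (fun k => 2 * Rpower (INR k.+1) (- ((1 + s) / 2)))).
- apply: filter_imp (near_above_one s s1) => v sv k.
  by apply: arg_factor_prime_le => //; lra.
- by apply: ex_series_arg_bound; lra.
- move=> k; apply: ex_derive_continuous.
  rewrite /arg_factor /prime_pow /Rpower; auto_derive.
  have p0 := prime_pow_gt0 s k; have ph := prime_pow_le_half s k ltac:(lra).
  have := polar_half_bounds (prime_pow s k) (prime_angle x t k) ltac:(lra).
  by rewrite /prime_pow /Rpower; lra.
Qed.

Lemma ex_series_zeta_arg (x : nat -> R) (t s : R) : 1 < s ->
  ex_series (fun k => arg_factor (prime_pow s k) (prime_angle x t k)).
Proof.
move=> s1; apply: (ex_series_le (V := R_CompleteNormedModule)) (ex_series_arg_bound s s1) => k.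
by apply: arg_factor_prime_le; lra.
Qed.

(** * Values of zeta_x at fixed height, and their polar form *)

Definition line_term (x : nat -> R) (t s : R) (n : nat) : C :=
  zeta_term x (RtoC s + Ci * RtoC t)%C n.

Definition line_angle (x : nat -> R) (t : R) (n : nat) : R :=
  exponents_dot n x - t * ln (INR n).

Lemma zeta_term_mul_prime (x : nat -> R) (t s : R) (k n : nat) : (0 < n)%N ->
  line_term x t s (nth_prime k * n)%N = (line_term x t s (nth_prime k) * line_term x t s n)%C.
Proof.
move=> n0; have p0 := nth_prime_gt0 k.
rewrite /line_term !zeta_term_polar polar_mul exponents_dot_mul // -multE mult_INR.
have a0 := ltR0_INR _ p0; have b0 := ltR0_INR _ n0.
by rewrite -Rpower_mult_distr // ln_mult //; congr polar; ring.
Qed.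

Lemma zeta_term1 (x : nat -> R) (t s : R) : line_term x t s 1%N = RtoC 1.
Proof.
rewrite /line_term zeta_term_polar /polar.
have -> : exponents_dot 1 x = 0.
  have := exponents_dot_mul x 1 1 isT isT; rewrite muln1; lra.
rewrite /= ln_1 /Rpower ln_1 !Rmult_0_r exp_0 Rminus_0_r cos_0 sin_0.
by congr (_, _); ring.
Qed.

Lemma Cmod_zeta_term (x : nat -> R) (t s : R) (n : nat) :
  Cmod (line_term x t s n) = Rpower (INR n) (- s).
Proof. by rewrite /line_term zeta_term_polar Cmod_polar //; apply/Rlt_le/exp_pos. Qed.

(** Absolute convergence supplies a sum, and uniqueness of limits identifies it with the value
    chosen by [iota]. *)
Lemma is_series_zeta (x : nat -> R) (t s : R) : 1 < s ->
  is_series (V := C_NormedModule) (fun n => line_term x t s n.+1) (zeta x (RtoC s + Ci * RtoC t)%C).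
Proof.
move=> s1.
have [S fS] : ex_series (V := C_NormedModule) (fun n => line_term x t s n.+1).
  apply: (ex_series_le (V := C_CompleteNormedModule) _ _ _ (ex_series_Rpower s s1)) => n.
  by change (Cmod (line_term x t s n.+1) <= Rpower (INR n.+1) (- s)); rewrite Cmod_zeta_term; lra.
suff -> : zeta x (RtoC s + Ci * RtoC t)%C = S by [].
exact: (iota_filterlim_locally (V := C_CompleteNormedModule) (F := eventually)
  (sum_n (G := C_AbelianMonoid) (fun n => line_term x t s n.+1)) S fS).
Qed.

(** Real and imaginary parts are separated so that the real M-test yields continuity of zeta. *)
Lemma zeta_components (x : nat -> R) (t s : R) : 1 < s -> zeta x (RtoC s + Ci * RtoC t)%C =
  (Series (fun n => Rpower (INR n.+1) (- s) * cos (line_angle x t n.+1)),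
   Series (fun n => Rpower (INR n.+1) (- s) * sin (line_angle x t n.+1))).
Proof.
move=> /(is_series_zeta x t); case: (zeta _ _) => a b fS.
have fS' : filterlim (sum_n (G := C_AbelianMonoid) (fun n => line_term x t s n.+1)) eventually
    (locally (T := prod_UniformSpace R_UniformSpace R_UniformSpace) (a, b)) := fS.
have E n : sum_n (G := C_AbelianMonoid) (fun n => line_term x t s n.+1) n =
  (sum_n (fun n => Rpower (INR n.+1) (- s) * cos (line_angle x t n.+1)) n,
   sum_n (fun n => Rpower (INR n.+1) (- s) * sin (line_angle x t n.+1)) n).
  elim: n => [|n IH]; first by rewrite !sum_O /line_term zeta_term_polar.
  by rewrite sum_Sn !sum_SnR IH /line_term zeta_term_polar.
congr (_, _); symmetry; apply: is_series_unique.
  apply: (filterlim_ext (fun n =>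
      fst (sum_n (G := C_AbelianMonoid) (fun n => line_term x t s n.+1) n))).
    by move=> n; rewrite E.
  exact: (filterlim_comp _ _ _ _ _ _ _ _ fS'
    (continuous_fst (U := R_UniformSpace) (V := R_UniformSpace) a b)).
apply: (filterlim_ext (fun n =>
      snd (sum_n (G := C_AbelianMonoid) (fun n => line_term x t s n.+1) n))).
  by move=> n; rewrite E.
exact: (filterlim_comp _ _ _ _ _ _ _ _ fS'
    (continuous_snd (U := R_UniformSpace) (V := R_UniformSpace) a b)).
Qed.

Lemma continuous_zeta (x : nat -> R) (t s : R) : 1 < s ->
  continuous (fun v : R => zeta x (RtoC v + Ci * RtoC t)%C) s.
Proof.
move=> s1.
apply: (continuous_ext_loc _ (fun v =>
  (Series (fun n => Rpower (INR n.+1) (- v) * cos (line_angle x t n.+1)),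
   Series (fun n => Rpower (INR n.+1) (- v) * sin (line_angle x t n.+1))))).
  apply: filter_imp (near_above_one s s1) => v sv.
  by symmetry; apply: zeta_components; lra.
have H (g : R -> R) : (forall a, -1 <= g a <= 1) -> continuous
  (fun v => Series (fun n => Rpower (INR n.+1) (- v) * g (line_angle x t n.+1))) s.
  move=> g1; apply: (continuous_Series _ (fun n => Rpower (INR n.+1) (- ((1 + s) / 2)))).
  - apply: filter_imp (near_above_one s s1) => v sv n.
    have := Rpower_neg_antitone (INR n.+1) ((1 + s) / 2) v (leq_INR 1 n.+1 isT) sv.
    have := Rpower_neg_pos (INR n.+1) v; have := g1 (line_angle x t n.+1) => *.
    by apply: Rabs_le; nra.
  - by apply: ex_series_Rpower; lra.
  - by move=> n; apply: ex_derive_continuous; rewrite /Rpower; auto_derive.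
have hc := H cos COS_bound; have hs := H sin SIN_bound.
apply: (filterlim_comp_2 _ _ pair hc hs) => P [d Pd].
by exists (ball (fst (Series (fun n => Rpower (INR n.+1) (- s) * cos (line_angle x t n.+1)),
   Series (fun n => Rpower (INR n.+1) (- s) * sin (line_angle x t n.+1)))) d) 
   (ball (Series (fun n => Rpower (INR n.+1) (- s) * sin (line_angle x t n.+1))) d);
  [exists d|exists d|move=> u v hu hv; apply: Pd; split].
Qed.

Lemma euler_prod_polar (x : nat -> R) (t s : R) (K : nat) : 1 < s ->
  euler_prod (line_term x t s) K.+1 = polar (Cmod (euler_prod (line_term x t s) K.+1))
    (- sum_n (fun k => arg_factor (prime_pow s k) (prime_angle x t k)) K).
Proof.
move=> s1.
have fac k : (1 - line_term x t s (nth_prime k))%C =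
    polar (Cmod (1 - line_term x t s (nth_prime k)))
      (- arg_factor (prime_pow s k) (prime_angle x t k)).
  rewrite /line_term zeta_term_polar exponents_dot_nth_prime; apply: one_sub_polar.
  split; first exact/Rlt_le/prime_pow_gt0.
  by apply: prime_pow_le_half; lra.
elim: K => [|K IH]; first by rewrite sum_O euler_prodS Cmult_1_l; exact: (fac 0%N).
rewrite sum_SnR euler_prodS Cmod_mult {1}IH {1}fac polar_mul.
by congr polar; ring.
Qed.

(** With P_K the product of the first K + 1 factors, z P_K tends to 1, so z is not 0; the argument
    of P_K is minus a partial sum of [zeta_arg], so in the limit z has argument [zeta_arg]. *)
Lemma zeta_arg_correct (x : nat -> R) (t s : R) : 1 < s ->
  let z := zeta x (RtoC s + Ci * RtoC t)%C in
  z <> RtoC 0 /\ z = polar (Cmod z) (zeta_arg x t s).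
Proof.
move=> s1 z.
pose w K := (z * euler_prod (line_term x t s) K.+1)%C.
have wl : is_lim_seq (fun K => Cmod (w K - 1)%C) 0.
  apply: (proj1 (is_lim_seq_incr_1 (fun K => Cmod (z * euler_prod (line_term x t s) K - 1)%C) _)).
  apply: euler_prod_lim (zeta_term1 x t s) (zeta_term_mul_prime x t s) (is_series_zeta x t s s1) _.
  by apply: ex_series_ext (ex_series_Rpower s s1) => n; rewrite Cmod_zeta_term.
clearbody z.
have near (g : nat -> R) : (forall K, Rabs (g K - 1) <= Cmod (w K - 1)%C) -> is_lim_seq g 1.
  move=> gw; apply: (is_lim_seq_ext (fun K => 1 + (g K - 1))) => [K|]; first by ring.
  suff : is_lim_seq (fun K => 1 + (g K - 1)) (1 + 0) by rewrite Rplus_0_r.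
  apply: is_lim_seq_plus' (is_lim_seq_const 1) _.
  apply/is_lim_seq_abs_0; apply: (is_lim_seq_le_le (fun _ => 0)) (is_lim_seq_const 0) wl => K.
  by split; [apply: Rabs_pos|].
split.
  move=> z0; have := is_lim_seq_unique _ _ wl.
  have -> : Lim_seq (fun K => Cmod (w K - 1)%C) = 1.
    rewrite -[RHS]Lim_seq_const; apply: Lim_seq_ext => K.
    by rewrite /w z0 Cmult_0_l -RtoC_minus Cmod_R Rabs_left; lra.
  by case; lra.
pose phi K := sum_n (fun k => arg_factor (prime_pow s k) (prime_angle x t k)) K.
have phil : is_lim_seq phi (zeta_arg x t s).
  exact: Series_correct (ex_series_zeta_arg x t s s1).
have modl : is_lim_seq (fun K => Cmod (w K)) 1.
  apply: near => K; have h := Cmod_triangle (w K - 1)%C 1%C.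
  have h' := Cmod_triangle (1 - w K)%C (w K).
  rewrite Cmod_1 in h; rewrite -[Cmod (1 - w K)]Cmod_opp in h'.
  have e1 : (w K - 1 + 1)%C = w K by ring.
  have e2 : (- (1 - w K))%C = (w K - 1)%C by ring.
  have e3 : (1 - w K + w K)%C = RtoC 1 by ring.
  rewrite e1 in h; rewrite e2 e3 Cmod_1 in h'.
  by apply: Rabs_le; lra.
have rel : is_lim_seq (fun K => fst (w K)) 1.
  by apply: near => K; apply: Rle_trans (Rmax_l _ _) (Rmax_Cmod (w K - 1)%C).
have iml : is_lim_seq (fun K => snd (w K)) 0.
  apply/is_lim_seq_abs_0; apply: (is_lim_seq_le_le (fun _ => 0)) (is_lim_seq_const 0) wl => K.
  split; first exact: Rabs_pos.
  apply: Rle_trans _ (Rmax_Cmod (w K - 1)%C); apply: Rle_trans _ (Rmax_r _ _).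
  by rewrite /= Ropp_0 Rplus_0_r; apply: Rle_refl.
have cosl : is_lim_seq (fun K => cos (phi K)) (cos (zeta_arg x t s)).
  by apply: is_lim_seq_continuous phil; apply: continuity_cos.
have sinl : is_lim_seq (fun K => sin (phi K)) (sin (zeta_arg x t s)).
  by apply: is_lim_seq_continuous phil; apply: continuity_sin.
(* Rotating by [phi K] cancels the argument of the product, so both sides are z |z| times its
   modulus. As [w K] tends to 1, this becomes the polar form of [z]. *)
have E K : (z * RtoC (Cmod (w K)) = RtoC (Cmod z) * (w K * polar 1 (phi K)))%C.
  rewrite /w Cmod_mult {2}euler_prod_polar // -/(phi K) -Cmult_assoc polar_mul.
  set r := Cmod (euler_prod _ _).
  rewrite Rplus_opp_l /polar cos_0 sin_0 !Rmult_1_r Rmult_0_r -/(RtoC r) RtoC_mult.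
  by ring.
rewrite [LHS]surjective_pairing; congr (_, _).
- have L : is_lim_seq (fun K => fst z * Cmod (w K)) (fst z * 1).
    exact: is_lim_seq_mult' (is_lim_seq_const _) modl.
  have L' : is_lim_seq (fun K => fst z * Cmod (w K))
      (Cmod z * (1 * cos (zeta_arg x t s) - 0 * sin (zeta_arg x t s))).
    apply: (is_lim_seq_ext (fun K => Cmod z * (fst (w K) * cos (phi K) - snd (w K) * sin (phi K)))).
      by move=> K; have := f_equal fst (E K); rewrite /= !Rmult_1_l; lra.
    apply: is_lim_seq_mult' (is_lim_seq_const _) _.
    by apply: is_lim_seq_minus'; apply: is_lim_seq_mult'.
  have := is_lim_seq_unique _ _ L; rewrite (is_lim_seq_unique _ _ L') => -[]; lra.
- have L : is_lim_seq (fun K => snd z * Cmod (w K)) (snd z * 1).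
    exact: is_lim_seq_mult' (is_lim_seq_const _) modl.
  have L' : is_lim_seq (fun K => snd z * Cmod (w K))
      (Cmod z * (1 * sin (zeta_arg x t s) + 0 * cos (zeta_arg x t s))).
    apply: (is_lim_seq_ext (fun K => Cmod z * (fst (w K) * sin (phi K) + snd (w K) * cos (phi K)))).
      by move=> K; have := f_equal snd (E K); rewrite /= !Rmult_1_l; lra.
    apply: is_lim_seq_mult' (is_lim_seq_const _) _.
    by apply: is_lim_seq_plus'; apply: is_lim_seq_mult'.
  have := is_lim_seq_unique _ _ L; rewrite (is_lim_seq_unique _ _ L') => -[]; lra.
Qed.

(** * Size and variation of the argument *)

Lemma zeta_arg_le (x : nat -> R) (t s : R) : 1 < s ->
  Rabs (zeta_arg x t s) <= Series (fun k => 2 * Rpower (INR k.+1) (- s)).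
Proof.
move=> s1.
have h k := arg_factor_prime_le x t s s k (Rlt_le _ _ s1) (Rle_refl s).
have eb := ex_series_arg_bound s s1.
apply: Rle_trans (Series_Rabs _ _) _.
  apply: (ex_series_le (V := R_CompleteNormedModule)) eb => k.
  by rewrite /norm /= /abs /= Rabs_Rabsolu.
by apply: Series_le eb => k; split; [apply: Rabs_pos|].
Qed.

(* sin (x_k - t ln p_k) = cos (t ln p_k + pi/2 - x_k) turns the linear part of
   the argument into the sum treated by the Riesz products. *)
Lemma zeta_arg_near (x : nat -> R) (t s : R) (N : nat) : 1 < s ->
  Rabs (zeta_arg x t s -
    sum_n (fun k => prime_pow s k * cos (prime_phase (fun k => PI / 2 - x k) k t)) N) <=
  (Series (fun k => 2 * Rpower (INR k.+1) (- s)) -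
    sum_n (fun k => 2 * Rpower (INR k.+1) (- s)) N) +
  Series (fun k => 6 * Rpower (INR k.+1) (- (2))).
Proof.
move=> s1.
set A := fun k => arg_factor (prime_pow s k) (prime_angle x t k).
have h1 : Rabs (zeta_arg x t s - sum_n A N) <= _ :=
  Series_sub_sum_n_le A _ N (fun k => arg_factor_prime_le x t s s k (Rlt_le _ _ s1) (Rle_refl s))
    (ex_series_arg_bound s s1).
set P := fun k => prime_pow s k * _.
pose c k := 6 * Rpower (INR k.+1) (- (2)).
have c0 k : 0 <= c k by have := Rpower_neg_pos (INR k.+1) 2; rewrite /c; lra.
have ec : ex_series c.
  exact: (ex_series_scal_l (V := R_NormedModule) 6 _ (ex_series_Rpower 2 ltac:(lra))).
have AP k : Rabs (A k - P k) <= c k.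
  have p0 := prime_pow_gt0 s k; have ph := prime_pow_le_half s k ltac:(lra).
  have [_] := arg_factor_bounds (prime_pow s k) (prime_angle x t k) ltac:(lra).
  have -> : prime_pow s k * sin (prime_angle x t k) = P k.
    rewrite /P -cos_shift /prime_phase /prime_angle; congr (_ * cos _); ring.
  move=> h; apply: Rle_trans h _; apply: Rmult_le_compat_l; first by lra.
  (* Squaring doubles the exponent to at least 2, so the quadratic error stays bounded as [s] tends
     to 1. *)
  have -> : prime_pow s k ^ 2 = prime_pow (2 * s) k.
    by rewrite /= Rmult_1_r -Rpower_plus; congr Rpower; ring.
  apply: Rle_trans (prime_pow_le (2 * s) k ltac:(lra)) _.
  by apply: Rpower_neg_antitone; [exact: (leq_INR 1 k.+1 isT)|lra].
have h2 : Rabs (sum_n A N - sum_n P N) <= Series c.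
  apply: Rle_trans (sum_n_le_Series c N c0 ec).
  elim: N {h1} => [|N IH]; first by rewrite !sum_O.
  rewrite !sum_SnR.
  have -> : sum_n A N + A N.+1 - (sum_n P N + P N.+1) =
    (sum_n A N - sum_n P N) + (A N.+1 - P N.+1) by ring.
  by apply: Rle_trans (Rabs_triang _ _) _; apply: Rplus_le_compat.
have -> : zeta_arg x t s - sum_n P N =
    (zeta_arg x t s - sum_n A N) + (sum_n A N - sum_n P N) by ring.
by apply: Rle_trans (Rabs_triang _ _) _; apply: Rplus_le_compat.
Qed.

Lemma zeta_arg_variation (x : nat -> R) (s0 A : R) : 1 < s0 ->
  exists s1 s2 L, [/\ 1 < s1 < s0, 1 < s2 < s0, 0 < L &
    forall a, exists t, a < t < a + L /\ A <= Rabs (zeta_arg x t s1 - zeta_arg x t s2)].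
Proof.
move=> s01; pose s2 := (1 + s0) / 2.
have s2b : 1 < s2 < s0 by rewrite /s2; lra.
pose C2 := Series (fun k => 2 * Rpower (INR k.+1) (- s2)).
pose C3 := Series (fun k => 6 * Rpower (INR k.+1) (- (2))).
(* The factor 2 undoes the mean 1/2. [C2] bounds the argument at [s2], [C3] the quadratic error, and
   the summand 2 pays for the tail at [s1] and for the loss [e = 1] in the mean estimate. *)
have [s1 [s1b [N0 HN0]]] := prime_sum_large (2 * (A + C2 + C3 + 2)) s0 s01.
have [N1 HN1] : exists N1, forall N, (N1 <= N)%N ->
    Series (fun k => 2 * Rpower (INR k.+1) (- s1)) -
    sum_n (fun k => 2 * Rpower (INR k.+1) (- s1)) N < 1.
  have /is_lim_seq_spec/(_ (mkposreal _ Rlt_0_1)) [N1 HN1] :=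
    Series_tail_lim _ (ex_series_arg_bound s1 (proj1 s1b)).
  by exists N1 => N /leP /HN1 /= /Rabs_lt_between; lra.
pose N := maxn N0 N1.
have [L [L0 HL]] := phase_sum_large (fun k => PI / 2 - x k) (prime_pow s1) N 1 Rlt_0_1.
exists s1, s2, L; split=> // a.
have [t [at_ ht]] := HL a; exists t; split=> //.
have h0 := HN0 N (leq_maxl _ _); have h1 := HN1 N (leq_maxr _ _).
have /Rabs_le_between h2 := zeta_arg_near x t s1 N (proj1 s1b).
have /Rabs_le_between h3 := zeta_arg_le x t s2 (proj1 s2b).
rewrite -/C3 in h2; rewrite -/C2 in h3.
apply: Rle_trans (Rle_abs _); lra.
Qed.

Lemma makes_turns_of_zeta_arg (x : nat -> R) (t s0 s1 s2 : R) (n : nat) :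
  1 < s1 < s0 -> 1 < s2 < s0 ->
  2 * PI * INR n <= Rabs (zeta_arg x t s1 - zeta_arg x t s2) ->
  makes_turns 1 s0 (fun s => zeta x (RtoC s + Ci * RtoC t)%C) n.
Proof.
move=> b1 b2 h; split=> [u [u1 _]|].
  by split; [apply: continuous_zeta|apply: (proj1 (zeta_arg_correct x t u u1))].
exists (zeta_arg x t); split; last by exists s1, s2.
move=> u [u1 _]; split; first exact: continuous_zeta_arg.
have [_ {1}->] := zeta_arg_correct x t u u1.
rewrite /polar /Cexp /RtoC /Ci /Cmult /Re /Im /=.
rewrite !(Rmult_0_l, Rmult_0_r, Rminus_0_r, Rmult_1_l, Rplus_0_l) exp_0.
by congr (_, _); ring.
Qed.

(** * Choice of the heights t *)

(** Odd indices give 0, 1, 2, ... and even ones 0, -1, -2, ...; both 0 and 1 are sent to 0, so the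
    indices m >= 1 still reach every integer. *)
Definition int_enum (m : nat) : Z := if odd m then Z.of_nat m./2 else Z.opp (Z.of_nat m./2).

Lemma int_enum_surj (j : Z) : exists m, (1 <= m)%N /\ int_enum m = j.
Proof.
case: (Z.lt_ge_cases j 0) => j0.
  exists (Z.to_nat (- j)).*2; split; first by rewrite double_gt0; apply/ltP; lia.
  by rewrite /int_enum odd_double doubleK; lia.
exists (Z.to_nat j).*2.+1; split=> //.
by rewrite /int_enum /= odd_double /= uphalf_double; lia.
Qed.

Theorem theorem3p8 :
  forall (x : nat -> R) (sigma0 : R) (n : nat),
    (1 < sigma0)%R ->
    exists t : nat -> R,
      relatively_dense (fun y : R => exists m : nat, (1 <= m)%N /\ y = t m) /\
      forall m : nat, (1 <= m)%N ->
        makes_turns 1 sigma0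
          (fun sigma : R => zeta x (RtoC sigma + Ci * RtoC (t m))%C) n.
Proof.
move=> x s0 n s01.
have [s1 [s2 [L [b1 b2 L0 HL]]]] := zeta_arg_variation x s0 (2 * PI * INR n) s01.
(* One height is picked in each interval from j L to (j + 1) L, j an integer. *)
pose t m := proj1_sig (constructive_indefinite_description _ (HL (IZR (int_enum m) * L))).
have tP m : IZR (int_enum m) * L < t m < IZR (int_enum m) * L + L /\
    2 * PI * INR n <= Rabs (zeta_arg x (t m) s1 - zeta_arg x (t m) s2).
  by rewrite /t; case: constructive_indefinite_description.
exists t; split; last first.
  by move=> m _; apply: makes_turns_of_zeta_arg b1 b2 (proj2 (tP m)).
(* The first multiple of [L] beyond [a] is at most a + L, so the cell starting there lies inside the
   interval from a to a + 2 L. *)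
exists (2 * L); split; first by lra.
move=> a; have [m [m1 Em]] := int_enum_surj (up (a / L)).
exists (t m); split; first by exists m.
have [] := tP m; rewrite Em => -[h1 h2] _; have [u1 u2] := archimed (a / L).
have e : a / L * L = a by field; lra.
have : a / L * L < IZR (up (a / L)) * L by apply: Rmult_lt_compat_r.
have : IZR (up (a / L)) * L <= (a / L + 1) * L by apply: Rmult_le_compat_r; lra.
lra.
Qed.
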